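(* Let $0<\alpha<1$. Then $$\|\mathcal{C}\|_{H^\infty_{\alpha,\log}\to H^\infty_\alpha}=\sup_{0\le r<1}\int_0^\infty\frac{(1+r)^\alpha e^{-t}\big(1-(1-e^{-t})r\big)^{2\alpha-1}}{\big(1-(1-2e^{-t})r\big)^\alpha\log\dfrac{2e^{1/\alpha}}{1-\left(\frac{re^{-t}}{1-(1-e^{-t})r}\right)^2}}\,dt,$$ and $$\|\mathcal{C}\|_{H^\infty_{\alpha,\log}\to H^\infty_\alpha}\ge\frac{1}{\frac1\alpha+\log 2}.$$
   Context: $\mathbb{D}$ is the open unit disc and $H(\mathbb{D})$ the space of analytic functions on $\mathbb{D}$. For $f(z)=\sum_{k\ge0}a_kz^k\in H(\mathbb{D})$ the Ces\`aro operator is $\mathcal{C}(f)(z)=\sum_{n\ge0}\Big(\frac{1}{n+1}\sum_{k=0}^n a_k\Big)z^n=\int_0^1\frac{f(tz)}{1-tz}\,dt$. For $0<\alpha<1$: the Korenblum space $H^\infty_\alpha$ consists of $f\in H(\mathbb{D})$ with $\|f\|_{H^\infty_\alpha}=\sup_{z\in\mathbb{D}}(1-|z|^2)^\alpha|f(z)|<\infty$; the logarithmically weighted Korenblum space $H^\infty_{\alpha,\log}$ consists of $f\in H(\mathbb{D})$ with $\|f\|_{H^\infty_{\alpha,\log}}=\sup_{z\in\mathbb{D}}(1-|z|^2)^\alpha\log\frac{2e^{1/\alpha}}{1-|z|^2}\,|f(z)|<\infty$. Operator norms are $\|\mathcal{C}\|_{X\to Y}=\sup\{\|\mathcal{C}f\|_Y:\|f\|_X\le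 1\}$. *)

(* Defs.v *)
From Stdlib Require Import Reals.
From Coquelicot Require Import Coquelicot.
Open Scope R_scope.

Definition analytic_disc (f : C -> C) (a : nat -> C) : Prop :=
  forall z : C, Cmod z < 1 -> is_pseries a z (f z).

Definition cesaro_coef (a : nat -> C) (n : nat) : C :=
  Cmult (RtoC (/ INR (S n))) (sum_n a n).

Definition korenblum_norm (alpha : R) (f : C -> C) : Rbar :=
  Lub_Rbar (fun x => exists z : C, Cmod z < 1 /\
     x = Rpower (1 - Cmod z ^ 2) alpha * Cmod (f z)).

Definition korenblum_log_norm (alpha : R) (f : C -> C) : Rbar :=
  Lub_Rbar (fun x => exists z : C, Cmod z < 1 /\
     x = Rpower (1 - Cmod z ^ 2) alpha
         * ln (2 * exp (1 / alpha) / (1 - Cmod z ^ 2)) * Cmod (f z)).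

(* ||C||_{H^infty_{alpha,log} -> H^infty_alpha}: sup of ||C f||_{H^infty_alpha}
   over analytic f (coefficients a) with ||f||_{H^infty_{alpha,log}} <= 1,
   where g = C f is the analytic function with coefficients cesaro_coef a. *)
Definition cesaro_opnorm (alpha : R) : Rbar :=
  Rbar_lub (fun y => exists (f g : C -> C) (a : nat -> C),
     analytic_disc f a /\ analytic_disc g (cesaro_coef a) /\
     Rbar_le (korenblum_log_norm alpha f) (Finite 1) /\
     y = korenblum_norm alpha g).

Definition integrand (alpha r t : R) : R :=
  Rpower (1 + r) alpha * exp (- t)
  * Rpower (1 - (1 - exp (- t)) * r) (2 * alpha - 1)
  / (Rpower (1 - (1 - 2 * exp (- t)) * r) alpha
     * ln (2 * exp (1 / alpha)
           / (1 - (r * exp (- t) / (1 - (1 - exp (- t)) * r)) ^ 2))).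

Definition integral_0_infty (F : R -> R) : Rbar :=
  Lim (fun b => RInt F 0 b) p_infty.

(* Main.v *)
Require Import Defs.
From Stdlib Require Import Reals Lra Lia.
From Coquelicot Require Import Coquelicot.
Open Scope R_scope.

(** Write [W(x) = 1 / ((1 - x^2)^alpha ln (2 e^(1/alpha) / (1 - x^2)))].  A change of
    variable turns the integral over [t] into
    [K(r) = (1 - r^2)^alpha * int_0^1 W(t r) / (1 - t r) dt].

    Upper bound: the derivative of [t * C f (t z)] is [f (t z) / (1 - t z)], whose modulus
    is at most [W(t |z|) / (1 - t |z|)] when [f] has norm at most 1.

    Lower bound: the extremal function is [1 / ((1 - z^2)^alpha ln (2 e^(1/alpha) / (1 - z^2)))],
    that is, [int_0^oo e^(- s A) (1 - z^2)^(s - alpha) ds] with [A = 1/alpha + ln 2].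
    Its right Riemann sums are finite combinations of binomial series, for which
    [|(1 - w)^beta| = |1 - w|^beta] is obtained by solving a differential equation on the
    segment [0, w].  They have norm at most 1, because [u^alpha (A - ln u)] is increasing
    for [0 < u <= 2], and for [0 <= x <= r] they are at least [W(x)] times a factor that
    depends on [r] only and tends to 1. *)

(** * Complex power series on the unit disc *)

Lemma fst_sum_n (u : nat -> C) (n : nat) :
  fst (sum_n u n) = sum_n (fun k => fst (u k)) n.
Proof.
  induction n as [|n IH]; [now rewrite !sum_O|].
  now rewrite !sum_Sn, <- IH.
Qed.

Lemma snd_sum_n (u : nat -> C) (n : nat) :
  snd (sum_n u n) = sum_n (fun k => snd (u k)) n.
Proof.
  induction n as [|n IH]; [now rewrite !sum_O|].
  now rewrite !sum_Sn, <- IH.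
Qed.

Lemma is_series_C_iff (u : nat -> C) (l : C) :
  @is_series C_AbsRing C_NormedModule u l <->
  is_series (fun n => fst (u n)) (fst l) /\
  is_series (fun n => snd (u n)) (snd l).
Proof.
  split.
  - intros H; split.
    + apply filterlim_ext with (fun n => fst (sum_n u n)); [intros; apply fst_sum_n|].
      eapply filterlim_comp; [exact H|].
      destruct l as [l1 l2]. apply (continuous_fst l1 l2).
    + apply filterlim_ext with (fun n => snd (sum_n u n)); [intros; apply snd_sum_n|].
      eapply filterlim_comp; [exact H|].
      destruct l as [l1 l2]. apply (continuous_snd l1 l2).
  - intros [H1 H2].
    apply filterlim_locally; intros eps.
    generalize (proj1 (filterlim_locally _ _) H1 eps).
    generalize (proj1 (filterlim_locally _ _) H2 eps).
    intros A B; generalize (filter_and _ _ A B).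
    apply filter_imp; intros n [h1 h2].
    rewrite <- snd_sum_n in h1; rewrite <- fst_sum_n in h2.
    split; assumption.
Qed.

Lemma pow_n_C (z : C) (n : nat) : @pow_n C_Ring z n = Cpow z n.
Proof. induction n as [|n IH]; [reflexivity|]. simpl. now rewrite IH. Qed.

Lemma is_pseries_C_iff (a : nat -> C) (z l : C) :
  is_pseries a z l <->
  is_series (fun n => Re (Cmult (Cpow z n) (a n))) (Re l) /\
  is_series (fun n => Im (Cmult (Cpow z n) (a n))) (Im l).
Proof.
  unfold is_pseries.
  rewrite (is_series_C_iff _ l).
  split; intros [H1 H2]; split;
  (eapply is_series_ext; [|eassumption]); intros n;
  change (@scal C_AbsRing C_NormedModule (pow_n z n) (a n)) with (Cmult (@pow_n C_Ring z n) (a n));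
  rewrite pow_n_C; reflexivity.
Qed.

(** Abel's lemma: the terms are dominated by the geometric sequence [M * (x / y) ^ n]. *)
Lemma pow_bounded_series (u : nat -> R) (M x y : R) :
  0 <= x < y -> (forall n, 0 <= u n) -> (forall n, u n * y ^ n <= M) ->
  ex_series (fun n => u n * x ^ n).
Proof.
  intros Hxy Hu HM.
  apply (@ex_series_le R_AbsRing R_CompleteNormedModule) with (fun n => M * (x / y) ^ n).
  - intros n. change (norm (u n * x ^ n)) with (Rabs (u n * x ^ n)).
    rewrite Rabs_pos_eq by (apply Rmult_le_pos; [apply Hu | apply pow_le; lra]).
    unfold Rdiv. rewrite Rpow_mult_distr, pow_inv.
    replace (u n * x ^ n) with ((u n * y ^ n) * (x ^ n * / y ^ n)).
    2:{ field. apply pow_nonzero; lra. }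
    apply Rmult_le_compat_r; [|apply HM].
    apply Rmult_le_pos; [apply pow_le; lra|].
    apply Rlt_le, Rinv_0_lt_compat, pow_lt; lra.
  - apply (@ex_series_scal R_AbsRing R_NormedModule M (fun n => (x / y) ^ n)), ex_series_geom.
    rewrite Rabs_pos_eq.
    + apply Rmult_lt_reg_r with y; [lra|]. unfold Rdiv. rewrite Rmult_assoc, Rinv_l; lra.
    + apply Rmult_le_pos; [lra|]. apply Rlt_le, Rinv_0_lt_compat; lra.
Qed.

Lemma ex_series_nonneg_bounded (u : nat -> R) :
  (forall n, 0 <= u n) -> ex_series u -> exists M, forall n, u n <= M.
Proof.
  intros Hu [l Hl]. exists l. intros n.
  apply Rle_trans with (sum_n u n).
  - destruct n; [rewrite sum_O; lra|].
    rewrite sum_Sn. change plus with Rplus; simpl.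
    rewrite sum_n_Reals. pose proof (cond_pos_sum u n Hu). lra.
  - rewrite sum_n_Reals. apply sum_incr; [|exact Hu].
    apply is_lim_seq_Reals. apply is_lim_seq_ext with (sum_n u).
    intros; apply sum_n_Reals. exact Hl.
Qed.

Lemma is_series_bounded (u : nat -> R) (l : R) :
  is_series u l -> exists M, forall n, Rabs (u n) <= M.
Proof.
  intros H.
  assert (H0 : is_lim_seq u 0) by (apply ex_series_lim_0; now exists l).
  destruct (maj_by_pos u) as [M [_ HM]].
  { exists 0. now apply is_lim_seq_Reals. }
  now exists M.
Qed.

(** A condition on the coefficients alone, equivalent to being the coefficients of an analytic
    function on the disc. It passes easily to partial sums and to Cesaro means, for which no
    function is available in advance. *)
Definition abs_summable_disc (a : nat -> C) : Prop :=
  forall x, 0 <= x < 1 -> ex_series (fun n => Cmod (a n) * x ^ n).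

Lemma analytic_abs_summable (f : C -> C) (a : nat -> C) :
  analytic_disc f a -> abs_summable_disc a.
Proof.
  intros H x Hx.
  (* Convergence at a point strictly between [x] and 1 bounds the terms there, which is what Abel's
     lemma needs. *)
  set (y := (x + 1) / 2).
  assert (Hy : Cmod (RtoC y) < 1).
  { rewrite Cmod_R, Rabs_pos_eq; unfold y; lra. }
  pose proof (H _ Hy) as Hs. apply is_pseries_C_iff in Hs. destruct Hs as [H1 H2].
  destruct (is_series_bounded _ _ H1) as [M1 HM1].
  destruct (is_series_bounded _ _ H2) as [M2 HM2].
  apply pow_bounded_series with (M := sqrt 2 * Rmax M1 M2) (y := y).
  - unfold y; lra.
  - intros; apply Cmod_ge_0.
  - intros n. specialize (HM1 n); specialize (HM2 n).
    rewrite <- (Rabs_pos_eq (y ^ n)) by (apply pow_le; unfold y; lra).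
    rewrite <- Cmod_R, RtoC_pow, <- Cmod_mult, Cmult_comm.
    eapply Rle_trans; [apply Cmod_2Rmax|].
    apply Rmult_le_compat_l; [apply sqrt_pos|].
    apply Rmax_lub.
    + eapply Rle_trans; [exact HM1|apply Rmax_l].
    + eapply Rle_trans; [exact HM2|apply Rmax_r].
Qed.

(** The real and imaginary series are summed separately, each dominated by the series of moduli.
    Outside the disc the witness takes default values, which [analytic_disc] does not constrain. *)
Lemma abs_summable_analytic (a : nat -> C) :
  abs_summable_disc a -> exists f, analytic_disc f a.
Proof.
  intros H.
  exists (fun z => (Series (fun n => Re (Cmult (Cpow z n) (a n))),
                    Series (fun n => Im (Cmult (Cpow z n) (a n))))).
  intros z Hz. apply is_pseries_C_iff.
  assert (Hn : forall n, Cmod (Cmult (Cpow z n) (a n)) = Cmod (a n) * Cmod z ^ n).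
  { intros n. rewrite Cmod_mult, Cmod_pow. ring. }
  specialize (H (Cmod z) (conj (Cmod_ge_0 z) Hz)).
  split; apply Series_correct;
  (eapply (@ex_series_le R_AbsRing R_CompleteNormedModule); [|exact H]);
  intros n; cbv beta; rewrite <- Hn;
  pose proof (Rmax_Cmod (Cmult (Cpow z n) (a n))) as HM.
  - eapply Rle_trans; [|exact HM]. apply Rmax_l.
  - eapply Rle_trans; [|exact HM]. apply Rmax_r.
Qed.

Section Ray.
Variables (a : nat -> C) (z : C).
Hypotheses (Ha : abs_summable_disc a) (Hz : Cmod z < 1).

(** Along the ray [t z] a complex power series becomes a pair of real power series in [t], to which
    real differentiation and integration apply. *)
Definition ray_re (n : nat) : R := Re (Cmult (Cpow z n) (a n)).
Definition ray_im (n : nat) : R := Im (Cmult (Cpow z n) (a n)).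

(** The radius strictly exceeds 1, so termwise differentiation is valid up to and including the
    endpoint [t = 1]. *)
Lemma ray_radius (u : nat -> R) :
  (forall n, Rabs (u n) <= Cmod (Cmult (Cpow z n) (a n))) ->
  Rbar_lt 1 (CV_radius u).
Proof.
  intros Hu.
  pose proof (Cmod_ge_0 z) as Hz0.
  set (x := (Cmod z + 1) / 2).
  assert (Hx : 0 <= x < 1) by (unfold x; lra).
  destruct (ex_series_nonneg_bounded _
    (fun n => Rmult_le_pos _ _ (Cmod_ge_0 (a n)) (pow_le x n (proj1 Hx))) (Ha x Hx)) as [M HM].
  (* With this [rho > 1] the product [Cmod z * rho] stays below [x], because
     [4 |z| <= (|z| + 1)^2]. *)
  set (rho := 2 / (Cmod z + 1)).
  assert (Hr : 1 < rho).
  { unfold rho. apply Rmult_lt_reg_r with (Cmod z + 1); [lra|].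
    unfold Rdiv; rewrite Rmult_assoc, Rinv_l; lra. }
  assert (Hrx : Cmod z * rho <= x).
  { unfold rho, x. apply Rmult_le_reg_r with (2 * (Cmod z + 1)); [lra|].
    field_simplify; [|lra]. nra. }
  apply Rbar_lt_le_trans with rho; [exact Hr|].
  apply (proj1 (CV_radius_bounded u)).
  exists M. intros n. rewrite Rabs_mult, (Rabs_pos_eq (rho ^ n)) by (apply pow_le; lra).
  eapply Rle_trans; [|apply (HM n)].
  eapply Rle_trans; [apply Rmult_le_compat_r; [apply pow_le; lra|apply Hu]|].
  rewrite Cmod_mult, Cmod_pow.
  replace (Cmod z ^ n * Cmod (a n) * rho ^ n) with (Cmod (a n) * (Cmod z * rho) ^ n)
    by (rewrite Rpow_mult_distr; ring).
  apply Rmult_le_compat_l; [apply Cmod_ge_0|].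
  apply pow_incr. split; [|exact Hrx]. apply Rmult_le_pos; lra.
Qed.

Lemma ray_re_radius : Rbar_lt 1 (CV_radius ray_re).
Proof.
  apply ray_radius. intros n.
  eapply Rle_trans; [|apply Rmax_Cmod]. apply Rmax_l.
Qed.

Lemma ray_im_radius : Rbar_lt 1 (CV_radius ray_im).
Proof.
  apply ray_radius. intros n.
  eapply Rle_trans; [|apply Rmax_Cmod]. apply Rmax_r.
Qed.

Lemma ray_value (f : C -> C) (t : R) :
  analytic_disc f a -> 0 <= t <= 1 ->
  f (Cmult (RtoC t) z) = (PSeries ray_re t, PSeries ray_im t).
Proof.
  intros Hf Ht.
  assert (Htz : Cmod (Cmult (RtoC t) z) < 1).
  { rewrite Cmod_mult, Cmod_R, Rabs_pos_eq by lra.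
    pose proof (Cmod_ge_0 z). nra. }
  pose proof (proj1 (is_pseries_C_iff _ _ _) (Hf _ Htz)) as [H1 H2].
  apply injective_projections; symmetry; apply is_pseries_unique, is_pseries_R;
  (eapply is_series_ext; [|eassumption]); intros n; simpl;
  rewrite Cpow_mult_l, <- RtoC_pow; unfold ray_re, ray_im;
  unfold Re, Im, RtoC, Cmult; simpl; ring.
Qed.
End Ray.

(** * The Cesaro operator along rays *)

Lemma Cmod_sum_n_le (u : nat -> C) (n : nat) :
  Cmod (sum_n u n) <= sum_n (fun k => Cmod (u k)) n.
Proof.
  induction n as [|n IH]; [rewrite !sum_O; lra|].
  rewrite !sum_Sn.
  eapply Rle_trans; [apply Cmod_triangle|].
  apply Rplus_le_compat_r, IH.
Qed.

(** For [k <= n] and [0 <= y <= 1] one has [y ^ n <= y ^ k], so the [n]-th partial sum times [y ^ n]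
    is bounded by the full series at [y]; Abel's lemma then gives summability at [x < y]. *)
Lemma abs_summable_partial_sums (a : nat -> C) :
  abs_summable_disc a -> abs_summable_disc (sum_n a).
Proof.
  intros Ha x Hx.
  set (y := (x + 1) / 2).
  destruct (Ha y) as [l Hl]; [unfold y; lra|].
  apply pow_bounded_series with (M := l) (y := y).
  - unfold y; lra.
  - intros; apply Cmod_ge_0.
  - intros n.
    assert (Hy : 0 <= y <= 1) by (unfold y; lra).
    apply Rle_trans with (sum_n (fun k => Cmod (a k) * y ^ k) n).
    + apply Rle_trans with (sum_n (fun k => Cmod (a k)) n * y ^ n).
      { apply Rmult_le_compat_r; [apply pow_le; lra|apply Cmod_sum_n_le]. }
      rewrite !sum_n_Reals, Rmult_comm, scal_sum.
      apply sum_Rle. intros k Hk.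
      apply Rmult_le_compat_l; [apply Cmod_ge_0|].
      replace n with (k + (n - k))%nat by lia.
      rewrite pow_add. rewrite <- (Rmult_1_r (y ^ k)) at 2.
      apply Rmult_le_compat_l; [apply pow_le; lra|].
      rewrite <- (pow1 (n - k)). apply pow_incr; lra.
    + rewrite sum_n_Reals. apply sum_incr.
      * apply is_lim_seq_Reals.
        apply is_lim_seq_ext with (sum_n (fun k => Cmod (a k) * y ^ k)).
        intros; apply sum_n_Reals. exact Hl.
      * intros k; apply Rmult_le_pos; [apply Cmod_ge_0|apply pow_le; lra].
Qed.

Lemma abs_summable_cesaro (a : nat -> C) :
  abs_summable_disc a -> abs_summable_disc (cesaro_coef a).
Proof.
  intros Ha x Hx.
  eapply (@ex_series_le R_AbsRing R_CompleteNormedModule);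
    [|apply (abs_summable_partial_sums a Ha x Hx)].
  intros n. change norm with Rabs.
  assert (H : 0 < / INR (S n)) by (apply Rinv_0_lt_compat, lt_0_INR; lia).
  assert (H1 : / INR (S n) <= 1).
  { rewrite <- Rinv_1. apply Rinv_le_contravar; [lra|].
    apply (le_INR 1); lia. }
  rewrite Rabs_pos_eq by (apply Rmult_le_pos; [apply Cmod_ge_0|apply pow_le; lra]).
  apply Rmult_le_compat_r; [apply pow_le; lra|].
  unfold cesaro_coef. rewrite Cmod_mult, Cmod_R, Rabs_pos_eq by lra.
  pose proof (Cmod_ge_0 (sum_n a n)). nra.
Qed.

Lemma is_pseries_C_inj (a : nat -> C) (z l1 l2 : C) :
  is_pseries a z l1 -> is_pseries a z l2 -> l1 = l2.
Proof.
  intros H1 H2. apply is_pseries_C_iff in H1, H2.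
  destruct H1 as [H1 H1'], H2 as [H2 H2'].
  apply injective_projections.
  - change (Re l1 = Re l2). now rewrite <- (is_series_unique _ _ H1), <- (is_series_unique _ _ H2).
  - change (Im l1 = Im l2). now rewrite <- (is_series_unique _ _ H1'), <- (is_series_unique _ _ H2').
Qed.

(** In [h z - z h z] the coefficients telescope to those of [f]. Thus [h] represents
    [f z / (1 - z)], the integrand of the Cesaro operator, as a power series. *)
Lemma partial_sums_generating_function (f h : C -> C) (a : nat -> C) (z : C) :
  analytic_disc f a -> analytic_disc h (sum_n a) -> Cmod z < 1 ->
  f z = Cmult (Cminus (RtoC 1) z) (h z).
Proof.
  intros Hf Hh Hz.
  apply is_pseries_C_inj with a z; [now apply Hf|].
  pose proof (is_pseries_minus _ _ _ _ _ (Hh z Hz) (is_pseries_incr_1 _ _ _ (Hh z Hz))) as H.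
  replace (Cmult (Cminus (RtoC 1) z) (h z))
    with (@plus C_AbelianGroup (h z) (opp (scal z (h z)))).
  - eapply is_pseries_ext; [|exact H].
    intros [|n]; unfold PS_minus, PS_plus, PS_opp, PS_incr_1.
    + rewrite sum_O. change (Cminus (a O) (RtoC 0) = a O). ring.
    + rewrite sum_Sn.
      change (Cminus (Cplus (sum_n a n) (a (S n))) (sum_n a n) = a (S n)). ring.
  - change (Cminus (h z) (Cmult z (h z)) = Cmult (Cminus (RtoC 1) z) (h z)). ring.
Qed.

(** Since [n + 1] times the [n]-th Cesaro coefficient is the [n]-th partial sum, the derivative of
    [t g(t z)] in [t] is [h(t z)]; integrating over [[0, 1]] gives [g z]. An arbitrary real
    functional [c1 Re + c2 Im] is carried along so that the modulus can be recovered by choosing a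
    direction. *)
Lemma cesaro_ray_integral (g h : C -> C) (a : nat -> C) (z : C) (c1 c2 : R) :
  analytic_disc g (cesaro_coef a) ->
  analytic_disc h (sum_n a) -> Cmod z < 1 ->
  is_RInt (fun t => c1 * Re (h (Cmult (RtoC t) z)) + c2 * Im (h (Cmult (RtoC t) z)))
    0 1 (c1 * Re (g z) + c2 * Im (g z)).
Proof.
  intros Hg Hh Hz.
  pose proof (analytic_abs_summable _ _ Hg) as Sg.
  pose proof (analytic_abs_summable _ _ Hh) as Sh.
  set (b := cesaro_coef a) in *.
  set (u1 := ray_re b z); set (u2 := ray_im b z).
  set (v1 := ray_re (sum_n a) z); set (v2 := ray_im (sum_n a) z).
  assert (Eg : g z = (PSeries u1 1, PSeries u2 1)).
  { replace (g z) with (g (Cmult (RtoC 1) z)) by (f_equal; ring).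
    apply (ray_value b z Hz g 1 Hg); lra. }
  assert (Hb : forall n, INR (S n) * u1 n = v1 n /\ INR (S n) * u2 n = v2 n).
  { intros n.
    assert (INR (S n) <> 0) by (apply not_0_INR; lia).
    unfold u1, u2, v1, v2, ray_re, ray_im, b, cesaro_coef, Re, Im, RtoC, Cmult.
    cbn [fst snd]. split; field; assumption. }
  assert (Hd : forall t u v, (forall n, INR (S n) * u n = v n) ->
     Rbar_lt 1 (CV_radius u) -> 0 <= t <= 1 ->
     is_derive (fun t => t * PSeries u t) t (PSeries v t)).
  { intros t u v Huv Hu Ht.
    apply is_derive_ext with (PSeries (PS_incr_1 u)); [intros; apply PSeries_incr_1|].
    rewrite (PSeries_ext v (PS_derive (PS_incr_1 u))) by (intros n; symmetry; apply Huv).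
    apply is_derive_PSeries. rewrite CV_radius_incr_1, Rabs_pos_eq by lra.
    eapply Rbar_le_lt_trans; [|exact Hu]. simpl; lra. }
  apply is_RInt_ext with (fun t => c1 * PSeries v1 t + c2 * PSeries v2 t).
  { intros t. rewrite Rmin_left, Rmax_right by lra. intros Ht.
    rewrite (ray_value (sum_n a) z Hz h t Hh) by lra. reflexivity. }
  replace (c1 * Re (g z) + c2 * Im (g z)) with
    (minus (c1 * (1 * PSeries u1 1) + c2 * (1 * PSeries u2 1))
           (c1 * (0 * PSeries u1 0) + c2 * (0 * PSeries u2 0))).
  2:{ rewrite Eg. unfold minus, plus, opp; simpl. ring. }
  apply (is_RInt_derive (fun t => c1 * (t * PSeries u1 t) + c2 * (t * PSeries u2 t))).
  - intros t. rewrite Rmin_left, Rmax_right by lra. intros Ht.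
    apply (is_derive_plus (fun t => c1 * (t * PSeries u1 t)) (fun t => c2 * (t * PSeries u2 t))).
    + apply is_derive_scal, Hd; [apply Hb|now apply ray_re_radius|lra].
    + apply is_derive_scal, Hd; [apply Hb|now apply ray_im_radius|lra].
  - intros t. rewrite Rmin_left, Rmax_right by lra. intros Ht.
    assert (Hlt : Rbar_le (Rabs t) 1) by (rewrite Rabs_pos_eq by lra; simpl; lra).
    apply (continuous_plus (fun t => c1 * PSeries v1 t) (fun t => c2 * PSeries v2 t)).
    + apply (continuous_scal_r c1 (PSeries v1)).
      apply continuity_pt_filterlim, PSeries_continuity.
      eapply Rbar_le_lt_trans; [exact Hlt|now apply ray_re_radius].
    + apply (continuous_scal_r c2 (PSeries v2)).
      apply continuity_pt_filterlim, PSeries_continuity.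
      eapply Rbar_le_lt_trans; [exact Hlt|now apply ray_im_radius].
Qed.

Lemma cesaro_modulus_le (f g : C -> C) (a : nat -> C) (z : C) (B : R -> R) (I : R) :
  analytic_disc f a -> analytic_disc g (cesaro_coef a) -> Cmod z < 1 ->
  (forall t, 0 <= t <= 1 -> Cmod (f (Cmult (RtoC t) z)) <= B t * (1 - t * Cmod z)) ->
  is_RInt B 0 1 I -> Cmod (g z) <= I.
Proof.
  intros Hf Hg Hz HB HI.
  destruct (abs_summable_analytic (sum_n a)) as [h Hh].
  { apply abs_summable_partial_sums. eapply analytic_abs_summable; eassumption. }
  assert (Hhb : forall t, 0 <= t <= 1 -> Cmod (h (Cmult (RtoC t) z)) <= B t).
  { intros t Ht. specialize (HB t Ht).
    pose proof (Cmod_ge_0 z) as Hz0.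
    assert (Hm : Cmod (Cmult (RtoC t) z) = t * Cmod z)
      by now rewrite Cmod_mult, Cmod_R, Rabs_pos_eq by lra.
    assert (Htz : t * Cmod z < 1) by nra.
    rewrite (partial_sums_generating_function f h a) in HB by (trivial; lra).
    rewrite Cmod_mult in HB.
    (* This lower bound for [|1 - t z|] turns the hypothesis on [f] into a bound on [h]. *)
    assert (H1 : 1 - t * Cmod z <= Cmod (Cminus (RtoC 1) (Cmult (RtoC t) z))).
    { pose proof (Cmod_triangle (Cminus (RtoC 1) (Cmult (RtoC t) z)) (Cmult (RtoC t) z)) as Ht1.
      replace (Cplus (Cminus (RtoC 1) (Cmult (RtoC t) z)) (Cmult (RtoC t) z))
        with (RtoC 1) in Ht1 by ring.
      rewrite Cmod_1, Hm in Ht1. lra. }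
    pose proof (Cmod_ge_0 (h (Cmult (RtoC t) z))). nra. }
  (* Every unit direction is bounded first. The direction of [g z] itself then yields its modulus,
     with [g z = 0] treated apart because it has no direction. *)
  assert (Hc : forall c1 c2, c1 * c1 + c2 * c2 = 1 -> c1 * Re (g z) + c2 * Im (g z) <= I).
  { intros c1 c2 Hc.
    refine (is_RInt_le _ B 0 1 _ I Rle_0_1 (cesaro_ray_integral g h a z c1 c2 Hg Hh Hz) HI _).
    intros t Ht. eapply Rle_trans; [|apply Hhb; lra].
    destruct (h (Cmult (RtoC t) z)) as [x y]; unfold Cmod, Re, Im; cbn [fst snd].
    apply Rle_trans with (Rabs (c1 * x + c2 * y)); [apply Rle_abs|].
    rewrite <- sqrt_Rsqr_abs. apply sqrt_le_1_alt. unfold Rsqr.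
    (* Cauchy-Schwarz, from [(c1 x + c2 y)^2 + (c1 y - c2 x)^2 = (c1^2 + c2^2) (x^2 + y^2)]. *)
    pose proof (Rle_0_sqr (c1 * y - c2 * x)) as Hs. unfold Rsqr in Hs.
    replace (x ^ 2 + y ^ 2) with ((c1 * c1 + c2 * c2) * (x ^ 2 + y ^ 2)) by (rewrite Hc; ring).
    nra. }
  destruct (Req_dec (Cmod (g z)) 0) as [H0|H0].
  - rewrite H0. apply Cmod_eq_0 in H0. specialize (Hc 1 0 ltac:(ring)).
    rewrite H0 in Hc. simpl in Hc. lra.
  - pose proof (Cmod2_alt (g z)) as Hsq.
    specialize (Hc (Re (g z) / Cmod (g z)) (Im (g z) / Cmod (g z))).
    replace (Re (g z) / Cmod (g z) * Re (g z) + Im (g z) / Cmod (g z) * Im (g z))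
      with (Cmod (g z)) in Hc.
    + apply Hc. transitivity ((Re (g z) ^ 2 + Im (g z) ^ 2) / Cmod (g z) ^ 2).
      { field; assumption. }
      rewrite <- Hsq. field; assumption.
    + transitivity ((Re (g z) ^ 2 + Im (g z) ^ 2) / Cmod (g z)).
      { rewrite <- Hsq. field; assumption. }
      field; assumption.
Qed.

(** On the positive axis the denominator [1 - t r] is a positive real, so a lower bound on the real
    part survives the division; then [Re (g r) <= |g r|]. *)
Lemma cesaro_modulus_ge (f g : C -> C) (a : nat -> C) (r : R) (B : R -> R) (I : R) :
  analytic_disc f a -> analytic_disc g (cesaro_coef a) -> 0 <= r < 1 ->
  (forall t, 0 <= t <= 1 -> B t * (1 - t * r) <= Re (f (RtoC (t * r)))) ->
  is_RInt B 0 1 I -> I <= Cmod (g (RtoC r)).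
Proof.
  intros Hf Hg Hr HB HI.
  destruct (abs_summable_analytic (sum_n a)) as [h Hh].
  { apply abs_summable_partial_sums. eapply analytic_abs_summable; eassumption. }
  assert (Hz : Cmod (RtoC r) < 1) by (rewrite Cmod_R, Rabs_pos_eq; lra).
  apply Rle_trans with (1 * Re (g (RtoC r)) + 0 * Im (g (RtoC r))).
  2:{ rewrite Rmult_1_l, Rmult_0_l, Rplus_0_r. eapply Rle_trans; [apply Rle_abs|].
      eapply Rle_trans; [|apply Rmax_Cmod]. apply Rmax_l. }
  refine (is_RInt_le B _ 0 1 I _ Rle_0_1 HI (cesaro_ray_integral g h a (RtoC r) 1 0 Hg Hh Hz) _).
  intros t Ht. specialize (HB t ltac:(lra)).
  assert (Htr : 0 <= t * r < 1) by nra.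
  rewrite <- RtoC_mult.
  rewrite (partial_sums_generating_function f h a) in HB;
    [|assumption|assumption|rewrite Cmod_R, Rabs_pos_eq; lra].
  destruct (h (RtoC (t * r))) as [x y].
  unfold Re, Im, Cminus, Cplus, Copp, Cmult, RtoC in *; cbn [fst snd] in *.
  apply Rmult_le_reg_r with (1 - t * r); [lra|].
  eapply Rle_trans; [exact HB|]. apply Req_le; ring.
Qed.

(** * Binomial series *)

(* Taylor coefficients of [(1 - w)^beta]. *)
Fixpoint binom_coef (beta : R) (n : nat) : R :=
  match n with
  | O => 1
  | S m => binom_coef beta m * ((INR m - beta) / INR (S m))
  end.

(** The majorant is the series of [(1 - w)^(- |beta| - 1)]. The extra 1 keeps its coefficients
    positive even when [beta = 0], as the ratio test requires. *)
Lemma binom_coef_majorant (beta : R) (n : nat) :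
  Rabs (binom_coef beta n) <= binom_coef (- (Rabs beta + 1)) n /\
  0 < binom_coef (- (Rabs beta + 1)) n.
Proof.
  induction n as [|n [IH1 IH2]]; cbn [binom_coef]; [rewrite Rabs_R1; lra|].
  assert (Hn : 0 < INR (S n)) by (apply lt_0_INR; lia).
  pose proof (pos_INR n) as Hn0. pose proof (Rabs_pos beta) as Hb.
  split.
  - rewrite Rabs_mult. apply Rmult_le_compat; try apply Rabs_pos; [exact IH1|].
    unfold Rdiv. rewrite Rabs_mult, (Rabs_pos_eq (/ INR (S n)))
      by now apply Rlt_le, Rinv_0_lt_compat.
    apply Rmult_le_compat_r; [now apply Rlt_le, Rinv_0_lt_compat|].
    unfold Rabs; destruct (Rcase_abs _), (Rcase_abs _); lra.
  - apply Rmult_lt_0_compat; [exact IH2|]. apply Rdiv_lt_0_compat; lra.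
Qed.

Lemma binom_coef_radius (b : R) :
  0 < b -> (forall n, 0 < binom_coef (- b) n) -> CV_radius (binom_coef (- b)) = 1.
Proof.
  intros Hb Hpos.
  rewrite <- Rinv_1.
  apply CV_radius_finite_DAlembert; [intros n; specialize (Hpos n); lra|lra|].
  apply is_lim_seq_ext with (fun n => 1 + (b - 1) * / INR (S n)).
  - intros n. cbn [binom_coef].
    assert (Hn : 0 < INR (S n)) by (apply lt_0_INR; lia).
    assert (E : binom_coef (- b) n * ((INR n - - b) / INR (S n)) / binom_coef (- b) n
                = (INR n + b) / INR (S n)).
    { specialize (Hpos n). field. split; apply Rgt_not_eq; assumption. }
    rewrite E, Rabs_pos_eq.
    + rewrite S_INR in *. field. lra.
    + pose proof (pos_INR n). apply Rlt_le, Rdiv_lt_0_compat; lra.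
  - replace (Finite 1) with (Finite (1 + (b - 1) * 0)) by (f_equal; ring).
    apply is_lim_seq_plus'; [apply is_lim_seq_const|].
    apply (is_lim_seq_scal_l _ (b - 1) 0).
    apply (is_lim_seq_incr_1 (fun n => / INR n)).
    replace (Finite 0) with (Rbar_inv p_infty) by reflexivity.
    apply is_lim_seq_inv; [apply is_lim_seq_INR|discriminate].
Qed.

Lemma binom_abs_summable (beta : R) :
  abs_summable_disc (fun n => RtoC (binom_coef beta n)).
Proof.
  intros x Hx.
  assert (Hpos : forall n, 0 < binom_coef (- (Rabs beta + 1)) n)
    by (intros n; apply binom_coef_majorant).
  eapply (@ex_series_le R_AbsRing R_CompleteNormedModule).
  2:{ apply (CV_disk_inside (binom_coef (- (Rabs beta + 1))) x).
      rewrite binom_coef_radius; [|pose proof (Rabs_pos beta); lra|assumption].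
      rewrite Rabs_pos_eq; simpl; lra. }
  intros n. change norm with Rabs. cbv beta.
  rewrite Cmod_R, !Rabs_mult, Rabs_Rabsolu.
  apply Rmult_le_compat_r; [apply Rabs_pos|].
  rewrite (Rabs_pos_eq (binom_coef (- (Rabs beta + 1)) n)) by (apply Rlt_le, Hpos).
  apply binom_coef_majorant.
Qed.

(** The operator [t d/dt] multiplies the [n]-th coefficient by [n], so the factor [INR n - beta]
    becomes [t d/dt - beta], which is the operator [T] below acting on coefficients. *)
Lemma binom_recurrence_ode (beta x y : R) (u v : nat -> R) (t : R) :
  Rbar_lt (Rabs t) (CV_radius u) -> Rbar_lt (Rabs t) (CV_radius v) ->
  (forall n, INR (S n) * u (S n) = (INR n - beta) * (x * u n + y * v n)) ->
  PSeries (PS_derive u) t =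
    x * (t * PSeries (PS_derive u) t - beta * PSeries u t) +
    y * (t * PSeries (PS_derive v) t - beta * PSeries v t).
Proof.
  intros Hu Hv Hrec.
  set (T := fun w => PS_plus (PS_incr_1 (PS_derive w)) (PS_scal (- beta) w)).
  assert (HT : forall w n, T w n = (INR n - beta) * w n).
  { intros w [|n]; unfold T, PS_plus, PS_incr_1, PS_scal, PS_derive;
    change plus with Rplus; change scal with Rmult; change zero with 0.
    - simpl; ring.
    - change (INR (S n) * w (S n) + - beta * w (S n) = (INR (S n) - beta) * w (S n)). ring. }
  assert (Eu : forall w, Rbar_lt (Rabs t) (CV_radius w) ->
    ex_pseries (PS_incr_1 (PS_derive w)) t /\ ex_pseries (PS_scal (- beta) w) t).
  { intros w Hw; split.
    - apply ex_pseries_incr_1, ex_pseries_derive, Hw.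
    - apply ex_pseries_scal; [apply Rmult_comm|]. now apply CV_radius_inside. }
  assert (PT : forall w, Rbar_lt (Rabs t) (CV_radius w) ->
    PSeries (T w) t = t * PSeries (PS_derive w) t - beta * PSeries w t).
  { intros w Hw. destruct (Eu w Hw). unfold T.
    rewrite PSeries_plus, PSeries_incr_1, PSeries_scal by assumption. ring. }
  assert (ET : forall c w, Rbar_lt (Rabs t) (CV_radius w) -> ex_pseries (PS_scal c (T w)) t).
  { intros c w Hw. destruct (Eu w Hw).
    apply ex_pseries_scal; [apply Rmult_comm|]. now apply ex_pseries_plus. }
  rewrite <- !PT, <- !PSeries_scal, <- PSeries_plus by auto.
  apply PSeries_ext. intros n. unfold PS_derive. rewrite Hrec.
  unfold PS_plus, PS_scal. rewrite !HT.
  change plus with Rplus; change scal with Rmult. ring.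
Qed.

Section Binomial.
Variables (beta : R) (P : C -> C) (w : C).
Hypothesis HP : analytic_disc P (fun n => RtoC (binom_coef beta n)).
Hypothesis Hw : Cmod w < 1.

Let c (n : nat) : C := RtoC (binom_coef beta n).
Let u := ray_re c w.
Let v := ray_im c w.
Let U := PSeries u.
Let V := PSeries v.
Let U' := PSeries (PS_derive u).
Let V' := PSeries (PS_derive v).

Lemma binom_ray_radius (t : R) : 0 <= t <= 1 ->
  Rbar_lt (Rabs t) (CV_radius u) /\ Rbar_lt (Rabs t) (CV_radius v).
Proof.
  intros Ht.
  assert (Hlt : Rbar_le (Rabs t) 1) by (rewrite Rabs_pos_eq by lra; simpl; lra).
  split; (eapply Rbar_le_lt_trans; [exact Hlt|]).
  - now apply ray_re_radius; [apply binom_abs_summable|].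
  - now apply ray_im_radius; [apply binom_abs_summable|].
Qed.

(** These are the real and imaginary parts of [(1 - t w) p'(t) = - beta w p(t)] for
    [p(t) = P(t w)]. *)
Lemma binom_ray_ode (t : R) : 0 <= t <= 1 ->
  (1 - t * Re w) * U' t + t * Im w * V' t = - beta * (Re w * U t - Im w * V t) /\
  (1 - t * Re w) * V' t - t * Im w * U' t = - beta * (Re w * V t + Im w * U t).
Proof.
  intros Ht. destruct (binom_ray_radius t Ht) as [Ru Rv].
  assert (Hrec : forall n,
    INR (S n) * u (S n) = (INR n - beta) * (Re w * u n + - Im w * v n) /\
    INR (S n) * v (S n) = (INR n - beta) * (Re w * v n + Im w * u n)).
  { intros n. assert (Hn : INR (S n) <> 0) by (apply not_0_INR; lia).
    unfold u, v, ray_re, ray_im, c. rewrite Cpow_S. cbn [binom_coef].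
    destruct (Cpow w n) as [X Y]. destruct w as [x y].
    unfold Re, Im, RtoC, Cmult; cbn [fst snd]. split; field; exact Hn. }
  pose proof (binom_recurrence_ode beta _ _ u v t Ru Rv (fun n => proj1 (Hrec n))) as E1.
  pose proof (binom_recurrence_ode beta _ _ v u t Rv Ru (fun n => proj2 (Hrec n))) as E2.
  fold U V U' V' in E1, E2 |- *. split; lra.
Qed.

Lemma binom_ray_derive (t : R) : 0 <= t <= 1 ->
  is_derive U t (U' t) /\ is_derive V t (V' t).
Proof.
  intros Ht. destruct (binom_ray_radius t Ht) as [Ru Rv].
  split; now apply is_derive_PSeries.
Qed.

Lemma binom_ray_0 : U 0 = 1 /\ V 0 = 0.
Proof.
  unfold U, V. rewrite !PSeries_0.
  unfold u, v, ray_re, ray_im, c. simpl. split; ring.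
Qed.

Lemma binom_ray_1 : P w = (U 1, V 1).
Proof.
  replace (P w) with (P (Cmult (RtoC 1) w)) by (f_equal; ring).
  apply (ray_value c w Hw P 1 HP); lra.
Qed.

Lemma Re_lt_1 : Re w < 1.
Proof.
  eapply Rle_lt_trans; [apply Rle_abs|]. eapply Rle_lt_trans; [|exact Hw].
  eapply Rle_trans; [|apply Rmax_Cmod]. apply Rmax_l.
Qed.

(** The quantity [|P(t w)|^2 |1 - t w|^(- 2 beta)] has zero derivative on [[0, 1]] and equals 1 at
    [t = 0]. Only real powers of moduli occur, so no branch of the complex logarithm is chosen. *)
Lemma binom_modulus : Cmod (P w) = Rpower (Cmod (Cminus (RtoC 1) w)) beta.
Proof.
  set (x := Re w). set (y := Im w).
  (* [D t] is [|1 - t w|^2]. *)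
  set (D := fun t => (1 - t * x) ^ 2 + (t * y) ^ 2).
  assert (HD : forall t, 0 <= t <= 1 -> 0 < D t).
  { intros t Ht. unfold D. pose proof Re_lt_1 as Hx. fold x in Hx.
    assert (Htx : 0 < 1 - t * x) by (destruct (Rle_lt_dec x 0); nra).
    apply Rplus_lt_le_0_compat; [now apply pow_lt|apply pow2_ge_0]. }
  assert (E : (U 0 ^ 2 + V 0 ^ 2) * exp (- beta * ln (D 0)) =
              (U 1 ^ 2 + V 1 ^ 2) * exp (- beta * ln (D 1))).
  { apply (eq_is_derive (fun t => (U t ^ 2 + V t ^ 2) * exp (- beta * ln (D t))) 0 1); [|lra].
    intros t Ht. specialize (HD t Ht).
    destruct (binom_ray_derive t Ht) as [dU dV].
    destruct (binom_ray_ode t Ht) as [E1 E2]. fold x y in E1, E2.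
    unfold D in *.
    auto_derive.
    - repeat split; try (eexists; eassumption).
      replace ((1 + - (t * x)) ^ 2) with ((1 - t * x) ^ 2) by ring. exact HD.
    - rewrite (is_derive_unique (fun t => U t) t _ dU : Derive (fun t : R => U t) t = _),
        (is_derive_unique (fun t => V t) t _ dV : Derive (fun t : R => V t) t = _).
      change zero with 0.
      set (e := exp _).
      apply Rmult_eq_reg_r with ((1 - t * x) ^ 2 + (t * y) ^ 2); [|lra].
      rewrite Rmult_0_l.
      (* The derivative is multiplied by [D t] and regrouped around the real part of
         [conj((1 - t w) p) (1 - t w) p'], so that both differential equations can be
         substituted. *)
      transitivity (e * (2 * ((((1 - t * x) * U t + t * y * V t) *
          ((1 - t * x) * U' t + t * y * V' t) +
          ((1 - t * x) * V t - t * y * U t) * ((1 - t * x) * V' t - t * y * U' t)))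
          - beta * (- 2 * x * (1 - t * x) + 2 * t * y ^ 2) * (U t ^ 2 + V t ^ 2))).
      { simpl. field. simpl in HD. lra. }
      rewrite E1, E2. ring. }
  destruct binom_ray_0 as [U0 V0]. rewrite U0, V0 in E.
  assert (D0 : D 0 = 1) by (unfold D; ring).
  rewrite D0, ln_1, Rmult_0_r, exp_0 in E.
  assert (H1 : U 1 ^ 2 + V 1 ^ 2 = exp (beta * ln (D 1))).
  { replace (beta * ln (D 1)) with (- (- beta * ln (D 1))) by ring.
    rewrite exp_Ropp. pose proof (exp_pos (- beta * ln (D 1))).
    apply Rmult_eq_reg_r with (exp (- beta * ln (D 1))); [|lra].
    rewrite <- E. field. lra. }
  rewrite binom_ray_1.
  assert (HD1 : Cmod (Cminus (RtoC 1) w) = sqrt (D 1)).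
  { unfold Cmod, D, x, y. destruct w as [x' y']. simpl. f_equal. ring. }
  rewrite HD1. unfold Cmod; cbn [fst snd]. rewrite H1.
  pose proof (HD 1 ltac:(lra)) as HD1'.
  rewrite <- (Rpower_sqrt (D 1)), Rpower_mult by assumption.
  rewrite <- Rpower_sqrt by apply exp_pos.
  unfold Rpower. rewrite ln_exp. f_equal. ring.
Qed.

(** The modulus leaves the argument undetermined. For real [w] the imaginary series vanishes, and
    [U t * (1 - t w)^(- beta)] is constant. *)
Lemma binom_real_value : Im w = 0 -> P w = RtoC (Rpower (1 - Re w) beta).
Proof.
  intros Hy. set (x := Re w). pose proof Re_lt_1 as Hx. fold x in Hx.
  assert (HV : V 1 = 0).
  { unfold V. rewrite (PSeries_ext v (fun _ => 0)); [apply PSeries_const_0|].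
    intros n. unfold v, ray_im, c.
    assert (Hn : Im (Cpow w n) = 0).
    { induction n as [|n IH]; [reflexivity|]. rewrite Cpow_S.
      unfold Im, Cmult in *; cbn [fst snd]. rewrite IH, Hy. ring. }
    unfold Im, Cmult, RtoC in *; cbn [fst snd]. rewrite Hn. ring. }
  assert (E : U 0 * exp (- beta * ln (1 - 0 * x)) = U 1 * exp (- beta * ln (1 - 1 * x))).
  { apply (eq_is_derive (fun t => U t * exp (- beta * ln (1 - t * x))) 0 1); [|lra].
    intros t Ht. assert (Htx : 0 < 1 - t * x) by (destruct (Rle_lt_dec x 0); nra).
    destruct (binom_ray_derive t Ht) as [dU _].
    destruct (binom_ray_ode t Ht) as [E1 _]. rewrite Hy in E1. fold x in E1.
    auto_derive.
    - repeat split; [eexists; eassumption|lra].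
    - rewrite (is_derive_unique (fun t => U t) t _ dU : Derive (fun t : R => U t) t = _).
      change zero with 0.
      apply Rmult_eq_reg_r with (1 - t * x); [|lra].
      rewrite Rmult_0_l. set (e := exp _).
      transitivity (e * ((1 - t * x) * U' t + t * 0 * V' t + beta * x * U t)).
      { field. lra. }
      rewrite E1. ring. }
  destruct binom_ray_0 as [U0 _]. rewrite U0 in E.
  rewrite Rmult_0_l, Rminus_0_r, ln_1, Rmult_0_r, exp_0, !Rmult_1_l in E.
  rewrite binom_ray_1, HV. unfold RtoC. f_equal.
  unfold Rpower. replace (beta * ln (1 - x)) with (- (- beta * ln (1 - x))) by ring.
  rewrite exp_Ropp. pose proof (exp_pos (- beta * ln (1 - x))).
  apply Rmult_eq_reg_r with (exp (- beta * ln (1 - x))); [|lra].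
  rewrite <- E. field. lra.
Qed.
End Binomial.

(** * Test functions *)

Definition spread_coef (c : nat -> C) (n : nat) : C :=
  if Nat.even n then c (Nat.div2 n) else RtoC 0.

(** The odd terms vanish, so the partial sum up to [m] is that of [P] up to [Nat.div2 m], an index
    that tends to infinity. *)
Lemma analytic_comp_square (P : C -> C) (c : nat -> C) :
  analytic_disc P c -> analytic_disc (fun z => P (Cmult z z)) (spread_coef c).
Proof.
  intros HP z Hz.
  assert (Hzz : Cmod (Cmult z z) < 1).
  { rewrite Cmod_mult. pose proof (Cmod_ge_0 z). nra. }
  pose proof (HP _ Hzz) as H. unfold is_pseries in H |- *.
  set (T := fun n => @scal C_AbsRing C_NormedModule (pow_n (Cmult z z) n) (c n)) in H.
  set (S' := fun n => @scal C_AbsRing C_NormedModule (pow_n z n) (spread_coef c n)).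
  assert (He : forall k, S' (2 * k)%nat = T k).
  { intros k. unfold S', T, spread_coef. rewrite Nat.even_even, Nat.div2_double.
    change (Cmult (@pow_n C_Ring z (2 * k)) (c k) = Cmult (@pow_n C_Ring (Cmult z z) k) (c k)).
    rewrite !pow_n_C, Cpow_mult_l, <- Cpow_add_r.
    do 2 f_equal. lia. }
  assert (Ho : forall k, S' (2 * k + 1)%nat = zero).
  { intros k. unfold S', spread_coef. rewrite Nat.even_odd.
    apply (@scal_zero_r C_AbsRing C_NormedModule). }
  assert (Hs : forall k, sum_n S' (2 * k) = sum_n T k /\ sum_n S' (2 * k + 1) = sum_n T k).
  { assert (Hstep : forall k, sum_n S' (2 * k) = sum_n T k -> sum_n S' (2 * k + 1) = sum_n T k).
    { intros k Hk. replace (2 * k + 1)%nat with (S (2 * k)) by lia.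
      rewrite sum_Sn, Hk. replace (S (2 * k)) with (2 * k + 1)%nat by lia.
      rewrite Ho. apply plus_zero_r. }
    intros k. enough (Hk : sum_n S' (2 * k) = sum_n T k) by auto.
    induction k as [|k IH].
    - change (2 * 0)%nat with 0%nat. rewrite !sum_O. apply (He 0%nat).
    - replace (2 * S k)%nat with (S (2 * k + 1)) by lia.
      rewrite !sum_Sn, (Hstep k IH). replace (S (2 * k + 1)) with (2 * S k)%nat by lia.
      now rewrite He. }
  apply filterlim_ext with (fun m => sum_n T (Nat.div2 m)).
  - intros m. destruct (Nat.Even_or_Odd m) as [[k ->]|[k ->]].
    + rewrite Nat.div2_double. symmetry; apply Hs.
    + replace (Nat.div2 (2 * k + 1)) with k; [symmetry; apply Hs|].
      rewrite Nat.add_1_r. symmetry. apply Nat.div2_succ_double.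
  - apply filterlim_comp with eventually; [|exact H].
    intros Q [N HN]. exists (2 * N)%nat. intros n Hn. apply HN.
    rewrite Nat.div2_div; apply Nat.div_le_lower_bound; lia.
Qed.

(** Places [|1 - z^2|] between the weight variable [1 - |z|^2] and 2, inside the range where
    [log_weight] increases. *)
Lemma Cmod_one_minus_square (z : C) : Cmod z < 1 ->
  1 - Cmod z ^ 2 <= Cmod (Cminus (RtoC 1) (Cmult z z)) <= 2.
Proof.
  intros Hz. pose proof (Cmod_ge_0 z) as H0.
  assert (Hm : Cmod (Cmult z z) = Cmod z ^ 2) by (rewrite Cmod_mult; ring).
  split.
  - pose proof (Cmod_triangle (Cminus (RtoC 1) (Cmult z z)) (Cmult z z)) as Ht.
    replace (Cplus (Cminus (RtoC 1) (Cmult z z)) (Cmult z z)) with (RtoC 1) in Ht by ring.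
    rewrite Cmod_1, Hm in Ht. lra.
  - eapply Rle_trans; [apply Cmod_triangle|].
    rewrite Cmod_opp, Cmod_1, Hm. nra.
Qed.

Lemma analytic_power_one_minus_square (beta : R) :
  exists (p : C -> C) (a : nat -> C), analytic_disc p a /\
    (forall z, Cmod z < 1 ->
       Cmod (p z) = Rpower (Cmod (Cminus (RtoC 1) (Cmult z z))) beta) /\
    (forall x, 0 <= x < 1 -> p (RtoC x) = RtoC (Rpower (1 - x ^ 2) beta)).
Proof.
  destruct (abs_summable_analytic _ (binom_abs_summable beta)) as [P HP].
  exists (fun z => P (Cmult z z)), (spread_coef (fun n => RtoC (binom_coef beta n))).
  split; [|split].
  - now apply analytic_comp_square.
  - intros z Hz. apply (binom_modulus beta P); [exact HP|].
    rewrite Cmod_mult. pose proof (Cmod_ge_0 z). nra.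
  - intros x Hx. rewrite <- RtoC_mult.
    rewrite (binom_real_value beta P (RtoC (x * x)) HP).
    + do 2 f_equal. simpl. ring.
    + rewrite Cmod_R, Rabs_pos_eq; nra.
    + reflexivity.
Qed.

Lemma is_series_zero : is_series (fun _ : nat => 0) 0.
Proof.
  apply (is_lim_seq_ext (fun _ => 0) _ (Finite 0)); [|apply is_lim_seq_const].
  intros n. now rewrite sum_n_const, Rmult_0_r.
Qed.

(* Right Riemann sum with step [d] of [int_0^(N d) exp (- s A) u^(s - alpha) ds], whose
   limit is [u^(- alpha) / (A - ln u)]. *)
Fixpoint test_sum (A d alpha : R) (N : nat) (u : R) : R :=
  match N with
  | O => 0
  | S n => test_sum A d alpha n u
           + d * exp (- (INR (S n) * d * A)) * Rpower u (INR (S n) * d - alpha)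
  end.

(** Powers are added one at a time. Their coefficients are nonnegative, so the triangle inequality
    bounds the modulus by the same sum, with exact values on the positive axis. *)
Lemma test_function (A d alpha : R) (N : nat) : 0 <= d ->
  exists (f : C -> C) (a : nat -> C), analytic_disc f a /\
    (forall z, Cmod z < 1 ->
       Cmod (f z) <= test_sum A d alpha N (Cmod (Cminus (RtoC 1) (Cmult z z)))) /\
    (forall x, 0 <= x < 1 -> f (RtoC x) = RtoC (test_sum A d alpha N (1 - x ^ 2))).
Proof.
  intros Hd. induction N as [|n [f [a [Hf [Hm Hr]]]]].
  - destruct (abs_summable_analytic (fun _ => RtoC 0)) as [f Hf].
    { intros x Hx. apply ex_series_ext with (fun _ => 0).
      - intros n. now rewrite Cmod_0, Rmult_0_l.
      - exists 0. exact is_series_zero. }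
    assert (H0 : forall z, Cmod z < 1 -> f z = RtoC 0).
    { intros z Hz. apply is_pseries_C_inj with (fun _ => RtoC 0) z; [now apply Hf|].
      apply is_pseries_C_iff.
      split; apply is_series_ext with (fun _ => 0); try exact is_series_zero;
        intros n; unfold Re, Im, Cmult, RtoC; cbn [fst snd];
        now rewrite !Rmult_0_r, ?Rminus_0_r, ?Rplus_0_r. }
    exists f, (fun _ => RtoC 0). split; [exact Hf|split].
    + intros z Hz. rewrite H0, Cmod_0 by assumption. simpl; lra.
    + intros x Hx. apply H0. rewrite Cmod_R, Rabs_pos_eq; lra.
  - destruct (analytic_power_one_minus_square (INR (S n) * d - alpha)) as [p [b [Hp [Hpm Hpr]]]].
    set (k := d * exp (- (INR (S n) * d * A))).
    assert (Hk : 0 <= k) by (apply Rmult_le_pos; [exact Hd|apply Rlt_le, exp_pos]).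
    exists (fun z => Cplus (f z) (Cmult (RtoC k) (p z))), (PS_plus a (PS_scal (RtoC k) b)).
    split; [|split].
    + intros z Hz. apply (is_pseries_plus a (PS_scal (RtoC k) b)); [now apply Hf|].
      apply (is_pseries_scal (RtoC k) b); [apply Cmult_comm|now apply Hp].
    + intros z Hz. cbn [test_sum].
      eapply Rle_trans; [apply Cmod_triangle|].
      apply Rplus_le_compat; [now apply Hm|].
      rewrite Cmod_mult, Cmod_R, Rabs_pos_eq, Hpm by assumption. apply Rle_refl.
    + intros x Hx. rewrite Hr, Hpr by assumption. cbn [test_sum]. fold k.
      now rewrite <- RtoC_mult, <- RtoC_plus.
Qed.

(** The [k]-th term is [d u^(- alpha) q^k], so this is the finite geometric sum, cleared of its
    denominator. *)
Lemma test_sum_geometric (A d alpha : R) (N : nat) (u : R) :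
  let q := exp (- (d * (A - ln u))) in
  test_sum A d alpha N u * (1 - q) = Rpower u (- alpha) * (d * q * (1 - q ^ N)).
Proof.
  intros q. induction N as [|n IH]; [simpl; ring|].
  cbn [test_sum]. rewrite Rmult_plus_distr_r, IH.
  assert (Hq : exp (- (INR (S n) * d * A)) * Rpower u (INR (S n) * d - alpha)
               = Rpower u (- alpha) * q ^ S n).
  { rewrite <- Rpower_pow by apply exp_pos.
    unfold Rpower, q. rewrite ln_exp, <- !exp_plus. f_equal. ring. }
  rewrite (Rmult_assoc d (exp _) (Rpower u _)), Hq. simpl. ring.
Qed.

(** Right Riemann sums of a decreasing exponential stay below its integral: [1 + d L <= exp (d L)]
    gives [d L q <= 1 - q]. The norm bound therefore holds exactly for every step. *)
Lemma test_sum_le (A d alpha : R) (N : nat) (u : R) :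
  0 < d -> 0 < A - ln u ->
  test_sum A d alpha N u <= Rpower u (- alpha) / (A - ln u).
Proof.
  intros Hd HL. pose proof (test_sum_geometric A d alpha N u) as Hg. cbv zeta in Hg.
  set (L := A - ln u) in *. set (q := exp (- (d * L))) in *.
  assert (HdL : 0 < d * L) by now apply Rmult_lt_0_compat.
  assert (Hq0 : 0 < q) by apply exp_pos.
  assert (Hq1 : q < 1).
  { unfold q. rewrite <- exp_0. apply exp_increasing. lra. }
  assert (HqN : 0 <= q ^ N) by (apply pow_le; lra).
  assert (Hp : 0 < Rpower u (- alpha)) by apply exp_pos.
  assert (H1 : d * L * q <= 1 - q).
  { assert (E : exp (d * L) * q = 1).
    { unfold q. rewrite <- exp_plus, Rplus_opp_r. apply exp_0. }
    pose proof (exp_ineq1_le (d * L)). nra. }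
  apply Rmult_le_reg_r with (1 - q); [lra|]. rewrite Hg.
  apply Rmult_le_reg_r with L; [exact HL|].
  replace (Rpower u (- alpha) / L * (1 - q) * L) with (Rpower u (- alpha) * (1 - q))
    by (field; lra).
  rewrite Rmult_assoc. apply Rmult_le_compat_l; [lra|].
  apply Rle_trans with (d * L * q * 1); [|lra].
  replace (d * q * (1 - q ^ N) * L) with (d * L * q * (1 - q ^ N)) by ring.
  apply Rmult_le_compat_l; [|lra]. apply Rmult_le_pos; lra.
Qed.

(** From [1 - q <= d L]: the factor [q] is the discretisation loss and [1 - q ^ N] the truncation
    loss. *)
Lemma test_sum_ge (A d alpha : R) (N : nat) (u : R) :
  0 < d -> 0 < A - ln u ->
  exp (- (d * (A - ln u))) * (1 - exp (- (d * (A - ln u))) ^ N)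
    * (Rpower u (- alpha) / (A - ln u)) <= test_sum A d alpha N u.
Proof.
  intros Hd HL. pose proof (test_sum_geometric A d alpha N u) as Hg. cbv zeta in Hg.
  set (L := A - ln u) in *. set (q := exp (- (d * L))) in *.
  assert (HdL : 0 < d * L) by now apply Rmult_lt_0_compat.
  assert (Hq0 : 0 < q) by apply exp_pos.
  assert (Hq1 : q < 1).
  { unfold q. rewrite <- exp_0. apply exp_increasing. lra. }
  assert (HqN : q ^ N <= 1) by (rewrite <- (pow1 N); apply pow_incr; lra).
  assert (Hp : 0 < Rpower u (- alpha)) by apply exp_pos.
  assert (H1 : 1 - q <= d * L).
  { pose proof (exp_ineq1_le (- (d * L))) as He. fold q in He. lra. }
  apply Rmult_le_reg_r with (1 - q); [lra|]. rewrite Hg.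
  apply Rmult_le_reg_r with L; [exact HL|].
  replace (q * (1 - q ^ N) * (Rpower u (- alpha) / L) * (1 - q) * L)
    with ((q * (1 - q ^ N) * Rpower u (- alpha)) * (1 - q)) by (field; lra).
  replace (Rpower u (- alpha) * (d * q * (1 - q ^ N)) * L)
    with ((q * (1 - q ^ N) * Rpower u (- alpha)) * (d * L)) by ring.
  apply Rmult_le_compat_l; [|exact H1].
  apply Rmult_le_pos; [apply Rmult_le_pos|]; lra.
Qed.

(** * The weight and the change of variable *)

Lemma exp_le_compat (x y : R) : x <= y -> exp x <= exp y.
Proof. intros [H| ->]; [now apply Rlt_le, exp_increasing|apply Rle_refl]. Qed.

Lemma exp_opp_bounds (t : R) : 0 <= t -> 0 < exp (- t) <= 1.
Proof.
  intros Ht. split; [apply exp_pos|]. rewrite <- exp_0. apply exp_le_compat. lra.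
Qed.

Definition log_const (alpha : R) : R := 1 / alpha + ln 2.

(** The weight as a function of [m = 1 - |z|^2]; it is also evaluated at [m = |1 - z^2|], which may
    reach beyond 1. *)
Definition log_weight (alpha m : R) : R :=
  Rpower m alpha * ln (2 * exp (1 / alpha) / m).

Lemma ln_weight_arg (alpha m : R) : 0 < m ->
  ln (2 * exp (1 / alpha) / m) = log_const alpha - ln m.
Proof.
  intros Hm. pose proof (exp_pos (1 / alpha)).
  unfold Rdiv at 1. rewrite ln_mult, ln_mult, ln_exp, ln_Rinv; try lra.
  - unfold log_const. ring.
  - now apply Rinv_0_lt_compat.
Qed.

Lemma log_const_sub_ge (alpha m : R) : 0 < m <= 2 -> 1 / alpha <= log_const alpha - ln m.
Proof.
  intros Hm. unfold log_const.
  assert (ln m <= ln 2) by (apply ln_le; lra). lra.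
Qed.

Lemma log_weight_pos (alpha m : R) : 0 < alpha -> 0 < m <= 2 -> 0 < log_weight alpha m.
Proof.
  intros Ha Hm. unfold log_weight. rewrite ln_weight_arg by lra.
  apply Rmult_lt_0_compat; [apply exp_pos|].
  pose proof (log_const_sub_ge alpha m Hm).
  assert (0 < 1 / alpha) by (apply Rdiv_lt_0_compat; lra). lra.
Qed.

(* The constant [2 exp (1 / alpha)] is what makes the weight increase up to [m = 2]:
   with [B = ln (2 exp (1 / alpha) / u) >= 1 / alpha] and [y = ln (u / m)], the claim is
   [B + y <= exp (alpha y) B], which follows from [1 + alpha y <= exp (alpha y)]. *)
Lemma log_weight_incr (alpha m u : R) :
  0 < alpha -> 0 < m <= u -> u <= 2 -> log_weight alpha m <= log_weight alpha u.
Proof.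
  intros Ha Hm Hu. unfold log_weight. rewrite !ln_weight_arg by lra.
  pose proof (log_const_sub_ge alpha u ltac:(lra)) as HB.
  assert (Hln : ln m <= ln u) by (apply ln_le; lra).
  set (B := log_const alpha - ln u) in *. set (y := ln u - ln m).
  replace (log_const alpha - ln m) with (B + y) by (unfold B, y; ring).
  replace (Rpower u alpha) with (Rpower m alpha * exp (alpha * y))
    by (unfold Rpower, y; rewrite <- exp_plus; f_equal; ring).
  rewrite Rmult_assoc. apply Rmult_le_compat_l; [apply Rlt_le, exp_pos|].
  assert (Hy : 0 <= y) by (unfold y; lra).
  pose proof (exp_ineq1_le (alpha * y)) as He.
  assert (HaB : 1 <= alpha * B).
  { apply Rmult_le_compat_l with (r := alpha) in HB; [|lra].
    replace (alpha * (1 / alpha)) with 1 in HB by (field; lra). exact HB. }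
  assert (0 < B) by nra.
  nra.
Qed.

Definition cesaro_kernel (alpha r t : R) : R :=
  / (log_weight alpha (1 - (t * r) ^ 2) * (1 - t * r)).

Lemma one_minus_sq_pos (r t : R) : 0 <= r < 1 -> -1 <= t <= 1 ->
  0 < 1 - (t * r) ^ 2 <= 1 /\ 0 < 1 - t * r.
Proof.
  intros Hr Ht.
  assert (-1 < t * r < 1) by nra.
  assert (0 <= (t * r) ^ 2) by apply pow2_ge_0.
  split; [nra|lra].
Qed.

Lemma cesaro_kernel_continuous (alpha r t : R) :
  0 < alpha -> 0 <= r < 1 -> -1 <= t <= 1 -> continuous (cesaro_kernel alpha r) t.
Proof.
  intros Ha Hr Ht. destruct (one_minus_sq_pos r t Hr Ht) as [H1 H2].
  pose proof (log_weight_pos alpha (1 - (t * r) ^ 2) Ha ltac:(lra)) as H3.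
  apply (ex_derive_continuous (V := R_NormedModule)).
  unfold cesaro_kernel, log_weight, Rpower in *.
  auto_derive. simpl in *.
  replace (1 + - (t * r * (t * r * 1))) with (1 - t * r * (t * r * 1)) by ring.
  replace (1 + - (t * r)) with (1 - t * r) by ring.
  pose proof (exp_pos (1 / alpha)).
  repeat split; try lra.
  - apply Rmult_lt_0_compat; [lra|]. apply Rinv_0_lt_compat; lra.
  - apply Rgt_not_eq. apply Rmult_lt_0_compat; [|lra].
    exact H3.
Qed.

Lemma cesaro_kernel_RInt (alpha r s t : R) :
  0 < alpha -> 0 <= r < 1 -> -1 <= s <= t -> t <= 1 ->
  ex_RInt (cesaro_kernel alpha r) s t.
Proof.
  intros Ha Hr Hs Ht. apply (ex_RInt_continuous (V := R_CompleteNormedModule)).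
  intros x. rewrite Rmin_left, Rmax_right by lra. intros Hx.
  apply cesaro_kernel_continuous; lra.
Qed.

Definition cesaro_value (alpha r : R) : R :=
  Rpower (1 - r ^ 2) alpha * RInt (cesaro_kernel alpha r) 0 1.

(* The substitution is [T = s / d]; note [1 - (T r)^2 = (1 - r) (1 - (1 - 2 s) r) / d^2]. *)
Lemma integrand_subst (alpha r t : R) :
  0 < alpha -> 0 <= r < 1 -> 0 <= t ->
  let s := exp (- t) in let d := 1 - (1 - s) * r in
  integrand alpha r t =
    Rpower (1 - r ^ 2) alpha * ((1 - r) * s / d ^ 2 * cesaro_kernel alpha r (s / d)).
Proof.
  intros Ha Hr Ht s d.
  pose proof (exp_opp_bounds t Ht) as Hs. fold s in Hs.
  assert (Hd : 0 < d) by (unfold d; nra).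
  assert (Hd2 : 0 < 1 - (1 - 2 * s) * r) by nra.
  assert (HT : 0 <= s / d <= 1).
  { split; [apply Rlt_le, Rdiv_lt_0_compat; lra|].
    apply Rmult_le_reg_r with d; [lra|]. unfold Rdiv. rewrite Rmult_assoc, Rinv_l by lra.
    unfold d; nra. }
  destruct (one_minus_sq_pos r (s / d) Hr ltac:(lra)) as [H1 _].
  pose proof (log_weight_pos alpha _ Ha ltac:(split; [apply H1|lra])) as Hw.
  unfold integrand, cesaro_kernel, log_weight in *. fold s. fold d.
  replace (r * s / d) with (s / d * r) by (field; lra).
  set (L := ln _) in *.
  assert (E1 : 1 - s / d * r = (1 - r) / d) by (unfold d; field; fold d; lra).
  assert (E2 : Rpower (1 - (s / d * r) ^ 2) alpha
    = Rpower (1 - r) alpha * Rpower (1 - (1 - 2 * s) * r) alpha * / Rpower d (2 * alpha)).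
  { replace (1 - (s / d * r) ^ 2) with ((1 - r) * (1 - (1 - 2 * s) * r) * (/ d * / d))
      by (unfold d; field; fold d; lra).
    assert (Hid : 0 < / d) by now apply Rinv_0_lt_compat.
    rewrite <- !Rpower_mult_distr; try (repeat apply Rmult_lt_0_compat; lra).
    f_equal. rewrite <- Rpower_Ropp. unfold Rpower. rewrite ln_Rinv, <- exp_plus by lra.
    f_equal. ring. }
  assert (E3 : Rpower (1 - r ^ 2) alpha = Rpower (1 + r) alpha * Rpower (1 - r) alpha).
  { rewrite Rpower_mult_distr by lra. f_equal. ring. }
  assert (E4 : Rpower d (2 * alpha - 1) = Rpower d (2 * alpha) * / d).
  { unfold Rminus. rewrite Rpower_plus, Rpower_Ropp, Rpower_1 by lra. reflexivity. }
  rewrite E2 in Hw. rewrite E1, E2, E3, E4.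
  assert (P1 : 0 < Rpower (1 - r) alpha) by apply exp_pos.
  assert (P2 : 0 < Rpower (1 - (1 - 2 * s) * r) alpha) by apply exp_pos.
  assert (P3 : 0 < Rpower d (2 * alpha)) by apply exp_pos.
  assert (HL : L <> 0) by (intros E; rewrite E in Hw; lra).
  field. repeat split; lra.
Qed.

(** The substitution expresses the integral up to [b] as [G (exp (- b))]; continuity of [G] at 0
    gives the limit as [b] tends to infinity. *)
Lemma integral_0_infty_integrand (alpha r : R) : 0 < alpha -> 0 <= r < 1 ->
  integral_0_infty (integrand alpha r) = Finite (cesaro_value alpha r).
Proof.
  intros Ha Hr. unfold integral_0_infty. apply is_lim_unique.
  set (T := fun s => s / (1 - (1 - s) * r)).
  set (G := fun s => Rpower (1 - r ^ 2) alpha * RInt (cesaro_kernel alpha r) (T s) 1).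
  assert (HG : forall b, 0 <= b -> RInt (integrand alpha r) 0 b = G (exp (- b))).
  { intros b Hb.
    pose proof exp_opp_bounds as Hs.
    assert (Hd : forall t, 0 <= t -> 0 < 1 - (1 - exp (- t)) * r).
    { intros t Ht. specialize (Hs t Ht). nra. }
    assert (HT : forall t, 0 <= t -> 0 <= T (exp (- t)) <= 1).
    { intros t Ht. specialize (Hs t Ht). specialize (Hd t Ht). unfold T.
      split; [apply Rlt_le, Rdiv_lt_0_compat; lra|].
      apply Rmult_le_reg_r with (1 - (1 - exp (- t)) * r); [lra|].
      unfold Rdiv. rewrite Rmult_assoc, Rinv_l by lra. nra. }
    set (dT := fun t => - ((1 - r) * exp (- t) / (1 - (1 - exp (- t)) * r) ^ 2)).
    assert (HI : is_RInt (fun t => dT t * cesaro_kernel alpha r (T (exp (- t)))) 0 b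
      (RInt (cesaro_kernel alpha r) (T (exp (- 0))) (T (exp (- b))))).
    { apply (is_RInt_comp (V := R_CompleteNormedModule) (cesaro_kernel alpha r)
        (fun t => T (exp (- t))) dT).
      - intros t. rewrite Rmin_left, Rmax_right by lra. intros Ht.
        apply cesaro_kernel_continuous; trivial. specialize (HT t ltac:(lra)). lra.
      - intros t. rewrite Rmin_left, Rmax_right by lra. intros Ht.
        specialize (Hd t ltac:(lra)). split.
        + unfold T, dT. auto_derive; [lra|]. field. lra.
        + apply (ex_derive_continuous (V := R_NormedModule)).
          unfold dT. auto_derive. apply Rgt_not_eq. simpl.
          apply Rmult_lt_0_compat; lra. }
    (* [T (exp (- t))] decreases from 1, so the substituted integral runs backwards; the minus sign
       here compensates. *)
    apply (is_RInt_scal _ _ _ (- Rpower (1 - r ^ 2) alpha)) in HI.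
    apply (is_RInt_unique (V := R_CompleteNormedModule)) in HI.
    etransitivity; [|etransitivity; [exact HI|]].
    - apply RInt_ext. intros t.
      rewrite Rmin_left, Rmax_right by lra. intros Ht.
      rewrite integrand_subst by lra. change scal with Rmult. unfold dT, T.
      match goal with |- ?x = ?y => change (@eq R x y) end.
      field. specialize (Hd t ltac:(lra)). lra.
    - assert (ET : T (exp (- 0)) = 1) by (unfold T; rewrite Ropp_0, exp_0; field; lra).
      rewrite ET. unfold G.
      rewrite <- (opp_RInt_swap (V := R_CompleteNormedModule) (cesaro_kernel alpha r)).
      + change opp with Ropp. change scal with Rmult.
        match goal with |- ?x = ?y => change (@eq R x y) end. ring.
      + specialize (HT b Hb). apply cesaro_kernel_RInt; lra. }
  apply is_lim_ext_loc with (fun b => G (exp (- b))).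
  { exists 0. intros b Hb. symmetry. apply HG. lra. }
  assert (G0 : G 0 = cesaro_value alpha r).
  { unfold G, cesaro_value. do 2 f_equal. unfold T. field. lra. }
  rewrite <- G0. apply (is_lim_comp_continuous (fun b => exp (- b)) G).
  - apply is_lim_comp with m_infty; [apply is_lim_exp_m| |now exists 0].
    replace m_infty with (Rbar_opp p_infty) by reflexivity.
    apply is_lim_opp, is_lim_id.
  - apply (ex_derive_continuous (V := R_NormedModule)).
    apply ex_derive_scal.
    apply (ex_derive_comp (fun x => RInt (cesaro_kernel alpha r) x 1) T).
    + assert (T0 : T 0 = 0) by (unfold T; field; lra). rewrite T0.
      eexists. apply (is_derive_RInt' (V := R_NormedModule) (cesaro_kernel alpha r) _ 0 1).
      * exists (mkposreal 1 Rlt_0_1). intros x Hx.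
        apply (RInt_correct (V := R_CompleteNormedModule)), cesaro_kernel_RInt; trivial; try lra;
        change (Rabs (x - 0) < 1) in Hx; apply Rabs_def2 in Hx; lra.
      * apply cesaro_kernel_continuous; lra.
    + unfold T. auto_derive. lra.
Qed.

(** * Norms *)

Lemma Rbar_lub_correct (E : Rbar -> Prop) : Rbar_is_lub E (Rbar_lub E).
Proof. unfold Rbar_lub. now destruct (Rbar_ex_lub E). Qed.

Lemma log_norm_le_1 (alpha : R) (f : C -> C) :
  Rbar_le (korenblum_log_norm alpha f) (Finite 1) <->
  (forall z, Cmod z < 1 -> log_weight alpha (1 - Cmod z ^ 2) * Cmod (f z) <= 1).
Proof.
  unfold korenblum_log_norm.
  match goal with |- context [Lub_Rbar ?E] => destruct (Lub_Rbar_correct E) as [Hub Hlub] end.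
  split.
  - intros H z Hz.
    apply (Rbar_le_trans (Finite _) _ (Finite 1)) with (2 := H). apply Hub. now exists z.
  - intros H. apply Hlub. intros x [z [Hz ->]]. now apply H.
Qed.

Lemma korenblum_norm_ge (alpha : R) (g : C -> C) (z : C) : Cmod z < 1 ->
  Rbar_le (Finite (Rpower (1 - Cmod z ^ 2) alpha * Cmod (g z))) (korenblum_norm alpha g).
Proof.
  intros Hz. unfold korenblum_norm.
  apply (proj1 (Lub_Rbar_correct _)). now exists z.
Qed.

(** * The two bounds for the operator norm *)

Lemma cesaro_pointwise_le (alpha : R) (f g : C -> C) (a : nat -> C) (z : C) :
  0 < alpha -> analytic_disc f a -> analytic_disc g (cesaro_coef a) ->
  Rbar_le (korenblum_log_norm alpha f) (Finite 1) -> Cmod z < 1 ->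
  Rpower (1 - Cmod z ^ 2) alpha * Cmod (g z) <= cesaro_value alpha (Cmod z).
Proof.
  intros Ha Hf Hg Hn Hz. pose proof (Cmod_ge_0 z) as Hz0.
  pose proof (proj1 (log_norm_le_1 alpha f) Hn) as Hw.
  unfold cesaro_value. apply Rmult_le_compat_l; [apply Rlt_le, exp_pos|].
  apply (cesaro_modulus_le f g a z (cesaro_kernel alpha (Cmod z))); trivial.
  - intros t Ht.
    destruct (one_minus_sq_pos (Cmod z) t ltac:(lra) ltac:(lra)) as [H1 H2].
    assert (Hm : Cmod (Cmult (RtoC t) z) = t * Cmod z)
      by now rewrite Cmod_mult, Cmod_R, Rabs_pos_eq by lra.
    specialize (Hw (Cmult (RtoC t) z) ltac:(rewrite Hm; lra)). rewrite Hm in Hw.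
    pose proof (log_weight_pos alpha (1 - (t * Cmod z) ^ 2) Ha ltac:(lra)) as HW.
    unfold cesaro_kernel.
    apply Rmult_le_reg_l with (1 := HW). eapply Rle_trans; [exact Hw|].
    apply Req_le. field. split; lra.
  - apply (RInt_correct (V := R_CompleteNormedModule)), cesaro_kernel_RInt; lra.
Qed.

(** Replacing [1 - |z|^2] by [u = |1 - z^2|] only increases the weight, and the weight at [u] times
    the limit [u^(- alpha) / (A - ln u)] of the test sums is exactly 1. *)
Lemma test_function_admissible (alpha d : R) (N : nat) (f : C -> C) :
  0 < alpha -> 0 < d ->
  (forall z, Cmod z < 1 -> Cmod (f z) <=
     test_sum (log_const alpha) d alpha N (Cmod (Cminus (RtoC 1) (Cmult z z)))) ->
  Rbar_le (korenblum_log_norm alpha f) (Finite 1).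
Proof.
  intros Ha Hd Hf. apply log_norm_le_1. intros z Hz.
  pose proof (Cmod_ge_0 z) as Hz0.
  assert (Hm : 0 < 1 - Cmod z ^ 2) by nra.
  destruct (Cmod_one_minus_square z Hz) as [H1 H2].
  set (u := Cmod (Cminus (RtoC 1) (Cmult z z))) in *.
  pose proof (log_const_sub_ge alpha u ltac:(lra)) as HL.
  assert (0 < 1 / alpha) by (apply Rdiv_lt_0_compat; lra).
  pose proof (log_weight_pos alpha u Ha ltac:(lra)) as Hu.
  apply Rle_trans with (log_weight alpha u * (Rpower u (- alpha) / (log_const alpha - ln u))).
  - apply Rmult_le_compat.
    + pose proof (pow2_ge_0 (Cmod z)). apply Rlt_le, log_weight_pos; lra.
    + apply Cmod_ge_0.
    + apply log_weight_incr; lra.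
    + eapply Rle_trans; [now apply Hf|]. apply test_sum_le; lra.
  - unfold log_weight. rewrite ln_weight_arg by lra.
    rewrite Rpower_Ropp. apply Req_le. field. split; [apply Rgt_not_eq, exp_pos|lra].
Qed.

Lemma cesaro_opnorm_ge_approx (alpha r : R) (n : nat) : 0 < alpha -> 0 <= r < 1 ->
  Rbar_le (Finite (exp (- ((log_const alpha - ln (1 - r ^ 2)) / INR (S n)))
                   * (1 - exp (- (INR (S n) * log_const alpha))) * cesaro_value alpha r))
    (cesaro_opnorm alpha).
Proof.
  intros Ha Hr.
  set (A := log_const alpha). set (m := INR (S n)).
  assert (Hm : 0 < m) by (apply lt_0_INR; lia).
  assert (Him : 0 < / m) by now apply Rinv_0_lt_compat.
  (* The step is [1 / m] with [m^2] terms, so the mesh tends to 0 while the range [[0, m]] exhausts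
     the half-line. On [[0, r]] one has [1 - r^2 <= u <= 1], which bounds the two loss factors
     uniformly by those of [eta]. *)
  set (eta := exp (- ((A - ln (1 - r ^ 2)) / m)) * (1 - exp (- (m * A)))).
  destruct (test_function A (/ m) alpha (S n * S n) (Rlt_le _ _ Him))
    as [f [a [Hf [Hfm Hfr]]]].
  destruct (abs_summable_analytic (cesaro_coef a)) as [g Hg].
  { eapply abs_summable_cesaro, analytic_abs_summable, Hf. }
  assert (Hr1 : Cmod (RtoC r) = r) by now rewrite Cmod_R, Rabs_pos_eq.
  apply Rbar_le_trans with (korenblum_norm alpha g).
  2:{ unfold cesaro_opnorm. apply (proj1 (Rbar_lub_correct _)).
      exists f, g, a. repeat split; trivial.
      now apply (test_function_admissible alpha (/ m) (S n * S n)). }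
  eapply Rbar_le_trans; [|apply (korenblum_norm_ge alpha g (RtoC r)); lra].
  rewrite Hr1.
  change (eta * cesaro_value alpha r <= Rpower (1 - r ^ 2) alpha * Cmod (g (RtoC r))).
  unfold cesaro_value.
  replace (eta * (Rpower (1 - r ^ 2) alpha * RInt (cesaro_kernel alpha r) 0 1))
    with (Rpower (1 - r ^ 2) alpha * (eta * RInt (cesaro_kernel alpha r) 0 1)) by ring.
  apply Rmult_le_compat_l; [apply Rlt_le, exp_pos|].
  apply (cesaro_modulus_ge f g a r (fun t => eta * cesaro_kernel alpha r t)); trivial.
  - intros t Ht.
    destruct (one_minus_sq_pos r t Hr ltac:(lra)) as [H1 H2].
    assert (Htr : 0 <= t * r < 1) by nra.
    rewrite Hfr by assumption. cbn [Re RtoC fst].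
    set (u := 1 - (t * r) ^ 2) in *.
    pose proof (log_const_sub_ge alpha u ltac:(lra)) as HL. fold A in HL.
    assert (0 < 1 / alpha) by (apply Rdiv_lt_0_compat; lra).
    eapply Rle_trans; [|apply test_sum_ge; lra].
    assert (Hpu : 0 < Rpower u alpha) by apply exp_pos.
    replace (eta * cesaro_kernel alpha r t * (1 - t * r))
      with (eta * (Rpower u (- alpha) / (A - ln u))).
    2:{ unfold cesaro_kernel, log_weight. fold u. rewrite ln_weight_arg by lra. fold A.
        rewrite Rpower_Ropp. field. repeat split; lra. }
    apply Rmult_le_compat_r.
    { apply Rlt_le, Rdiv_lt_0_compat; [apply exp_pos|lra]. }
    assert (Hu : 1 - r ^ 2 <= u).
    { assert ((t * r) ^ 2 <= r ^ 2) by (apply pow_incr; nra). unfold u; lra. }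
    assert (Hln1 : ln (1 - r ^ 2) <= ln u) by (apply ln_le; nra).
    assert (Hln2 : ln u <= 0) by (rewrite <- ln_1; apply ln_le; lra).
    assert (HA : 0 < A).
    { pose proof (log_const_sub_ge alpha 1 ltac:(lra)) as HA. rewrite ln_1 in HA. fold A in HA. lra. }
    unfold eta. apply Rmult_le_compat.
    + apply Rlt_le, exp_pos.
    + assert (exp (- (m * A)) < 1); [|lra].
      rewrite <- exp_0. apply exp_increasing. nra.
    + apply exp_le_compat. unfold Rdiv. nra.
    + assert (E : exp (- (/ m * (A - ln u))) ^ (S n * S n) <= exp (- (m * A))); [|lra].
      rewrite <- Rpower_pow by apply exp_pos. unfold Rpower. rewrite ln_exp, mult_INR.
      fold m. apply exp_le_compat.
      replace (m * m * - (/ m * (A - ln u))) with (- (m * (A - ln u))) by (field; lra).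
      nra.
  - apply (is_RInt_scal (V := R_NormedModule) (cesaro_kernel alpha r)).
    apply (RInt_correct (V := R_CompleteNormedModule)), cesaro_kernel_RInt; lra.
Qed.

Lemma cesaro_opnorm_ge (alpha r : R) : 0 < alpha -> 0 <= r < 1 ->
  Rbar_le (Finite (cesaro_value alpha r)) (cesaro_opnorm alpha).
Proof.
  intros Ha Hr.
  set (A := log_const alpha). set (A' := A - ln (1 - r ^ 2)).
  assert (HA : 0 < A).
  { pose proof (log_const_sub_ge alpha 1 ltac:(lra)) as HA. rewrite ln_1 in HA. fold A in HA.
    assert (0 < 1 / alpha) by (apply Rdiv_lt_0_compat; lra). lra. }
  pose proof (fun n => cesaro_opnorm_ge_approx alpha r n Ha Hr) as H.
  fold A in H. fold A' in H.
  assert (Hlim : is_lim_seq (fun n => exp (- (A' / INR (S n)))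
    * (1 - exp (- (INR (S n) * A))) * cesaro_value alpha r) (cesaro_value alpha r)).
  { assert (HS : is_lim_seq (fun n => INR (S n)) p_infty)
      by apply (is_lim_seq_incr_1 INR), is_lim_seq_INR.
    assert (L1 : is_lim_seq (fun n => exp (- (A' / INR (S n)))) 1).
    { rewrite <- exp_0. apply (is_lim_seq_continuous exp (fun n => - (A' / INR (S n))) 0).
      - apply derivable_continuous_pt, derivable_pt_exp.
      - replace (Finite 0) with (Finite (- (A' * 0))) by (f_equal; ring).
        apply (proj1 (is_lim_seq_opp (fun n => A' / INR (S n)) (Finite (A' * 0)))).
        apply (is_lim_seq_scal_l (fun n => / INR (S n)) A' 0).
        replace (Finite 0) with (Rbar_inv p_infty) by reflexivity.
        apply is_lim_seq_inv; [exact HS|discriminate]. }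
    assert (L2 : is_lim_seq (fun n => exp (- (INR (S n) * A))) 0).
    { apply (is_lim_comp_seq exp (fun n => - (INR (S n) * A)) m_infty 0).
      - apply is_lim_exp_m.
      - exists 0%nat. intros; discriminate.
      - replace m_infty with (Rbar_opp p_infty) by reflexivity.
        apply (proj1 (is_lim_seq_opp (fun n => INR (S n) * A) p_infty)).
        replace p_infty with (Rbar_mult p_infty A).
        + apply (is_lim_seq_scal_r (fun n => INR (S n)) A p_infty), HS.
        + apply is_Rbar_mult_unique, is_Rbar_mult_p_infty_pos, HA. }
    replace (Finite (cesaro_value alpha r))
      with (Finite (1 * (1 - 0) * cesaro_value alpha r)) by (f_equal; ring).
    apply is_lim_seq_mult'; [|apply is_lim_seq_const].
    apply is_lim_seq_mult'; [exact L1|].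
    apply is_lim_seq_minus'; [apply is_lim_seq_const|exact L2]. }
  (* An infinite norm satisfies the bound trivially, and the value minus infinity contradicts any
     single approximate bound. *)
  destruct (cesaro_opnorm alpha) as [y| |].
  - apply (is_lim_seq_le _ (fun _ => y) (cesaro_value alpha r) y H Hlim), is_lim_seq_const.
  - exact I.
  - destruct (H 0%nat).
Qed.

(** At [r = 0] the kernel is constant in [t]; this value of the supremum gives the explicit lower
    bound. *)
Lemma cesaro_value_0 (alpha : R) : 0 < alpha ->
  cesaro_value alpha 0 = 1 / (1 / alpha + ln 2).
Proof.
  intros Ha. unfold cesaro_value.
  rewrite (RInt_ext _ (fun _ => 1 / (1 / alpha + ln 2))).
  - rewrite RInt_const. change scal with Rmult.
    replace (1 - 0 ^ 2) with 1 by ring. unfold Rpower. rewrite ln_1, Rmult_0_r, exp_0.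
    match goal with |- ?x = ?y => change (@eq R x y) end. ring.
  - intros t _. unfold cesaro_kernel, log_weight.
    replace (1 - (t * 0) ^ 2) with 1 by ring. replace (1 - t * 0) with 1 by ring.
    rewrite ln_weight_arg, ln_1 by lra. unfold Rpower, log_const.
    rewrite ln_1, Rmult_0_r, exp_0, Rmult_1_l, Rmult_1_r, Rminus_0_r.
    unfold Rdiv at 2. now rewrite Rmult_1_l.
Qed.

Theorem theorem4p1 (alpha : R) (Ha : 0 < alpha < 1) :
  cesaro_opnorm alpha =
    Rbar_lub (fun y => exists r : R, 0 <= r < 1 /\
                 y = integral_0_infty (integrand alpha r))
  /\ Rbar_le (Finite (1 / (1 / alpha + ln 2))) (cesaro_opnorm alpha).
Proof.
  destruct Ha as [Ha _]. split.
  - apply Rbar_le_antisym.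
    + unfold cesaro_opnorm at 1. apply (proj2 (Rbar_lub_correct _)).
      intros y [f [g [a [Hf [Hg [Hn ->]]]]]].
      apply (proj2 (Lub_Rbar_correct _)). intros x [z [Hz ->]].
      pose proof (Cmod_ge_0 z) as Hz0.
      (* The pointwise bound depends on [z] only through [Cmod z], which serves as [r] in the
         supremum. *)
      apply Rbar_le_trans with (Finite (cesaro_value alpha (Cmod z))).
      { exact (cesaro_pointwise_le alpha f g a z Ha Hf Hg Hn Hz). }
      apply (proj1 (Rbar_lub_correct _)). exists (Cmod z). split; [lra|].
      symmetry. apply integral_0_infty_integrand; lra.
    + apply (proj2 (Rbar_lub_correct _)). intros y [r [Hr ->]].
      rewrite integral_0_infty_integrand by lra. now apply cesaro_opnorm_ge.
  - rewrite <- cesaro_value_0 by exact Ha. apply cesaro_opnorm_ge; lra.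
Qed.
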